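(* Let $G$ be a generator over an alphabet $A$, with sets of locally controllable events $A_{c,i}\subseteq A$ and locally observable events $A_{o,i}\subseteq A$, $i=1,\dots,n$. Let $A_c=\bigcup_i A_{c,i}$, $A_o=\bigcup_i A_{o,i}$, $A_{uc}=A\setminus A_c$. Let $L=L(G)$ and let $K\subseteq L$ be a specification language over $A$. Let $\Sigma_1,\dots,\Sigma_n\subseteq A$ be extensions of the local alphabets $A_{o,1},\dots,A_{o,n}$ such that $A=\bigcup_{i=1}^n(A_{o,i}\cup\Sigma_i)$ and $K$ is separable with respect to $(A_{o,i}\cup\Sigma_i)_{i=1}^n$. Let $\Sigma_{o,i}=\Sigma_i\cap A_o$ and $\Sigma_{c,i}=\Sigma_i\cap A_c$, and assume $(A_{o,i}\cup\Sigma_{o,i})\cap A_c\subseteq A_{c,i}\cup\Sigma_{c,i}$ for all $i$. Let $P_{i+\Sigma_i}\colon A^*\to(A_{o,i}\cup\Sigma_i)^*$ be the projection. Let $R_i$, $i=1,\dots,n$, be languages over $A_{o,i}\cup\Sigma_i$ that are controllable with respect to $P_{i+\Sigma_i}(L)$ and $(A_{o,i}\cup\Sigma_i)\cap A_{uc}$, such that $\parallel_{i=1}^n R_i\subseteq K$, and such that either (1) the $R_i$ are normal with respect to $P_{i+\Sigma_i}(L)$ and $A_{o,i}\cup\Sigma_{o,i}$, or (2) the $R_i$ are observable with respect to $P_{i+\Sigma_i}(L)$ and $A_{o,i}\cup\Sigma_{o,i}$, and $A_c\subseteq A_o$. Let $\Sigma'\subseteq A$ contain all events shared by any pair of $R_i$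 and $R_j$, $i\neq j$ (that is, $(A_{o,i}\cup\Sigma_i)\cap(A_{o,j}\cup\Sigma_j)\subseteq\Sigma'$), let $\Sigma'_{uc}=\Sigma'\cap A_{uc}$, $\Sigma'_c=\Sigma'\cap A_c$, $\Sigma'_o=\Sigma'\cap A_o$, and suppose that the projection $P_{\Sigma'}\colon A^*\to\Sigma'^*$ is an $R_i$-observer for $i=1,\dots,n$. Let $L_C\subseteq\parallel_{i=1}^n P_{\Sigma'}(R_i)$ be a language that is controllable with respect to $P_{\Sigma'}(L)$ and $\Sigma'_{uc}$, and normal in case (1) (respectively observable in case (2)) with respect to $P_{\Sigma'}(L)$ and $\Sigma'_o$. If $(A_{o,i}\cup\Sigma_{o,i}\cup\Sigma'_o)\cap A_c\subseteq A_{c,i}\cup\Sigma_{c,i}\cup\Sigma'_c$ for all $i$, then $$\parallel_{i=1}^n(R_i\parallel L_C)$$ is a sublanguage of $K$ that is controllable with respect to $L$ and $A_{uc}$, normal in case (1) (respectively observable in case (2)) with respect to $L$ and $A_o$, and coobservable with respect to $L$ and $(A_{o,i}\cup\Sigma_{o,i}\cup\Sigma'_o)_{i=1}^n$, and its components $R_i\parallel L_C$, $i=1,\dots,n$, are synchronously nonconflicting.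
   Context: An alphabet is a finite nonempty set of events; all languages are assumed regular. A generator $G=(Q,A,f,q_0,Q_m)$ is a deterministic finite automaton with partial transition function $f$; its generated language is $L(G)=\{s\in A^*\mid f(q_0,s)\text{ is defined}\}$, which is prefix-closed. $\overline{L}$ denotes the prefix closure of $L$. For $Y\subseteq X$, the projection $X^*\to Y^*$ is the monoid morphism erasing the events of $X\setminus Y$ and keeping those of $Y$. For $L_i\subseteq X_i^*$, $X=\bigcup_i X_i$, the synchronous product is $\parallel_i L_i=\bigcap_i P_i^{-1}(L_i)\subseteq X^*$, with $P_i\colon X^*\to X_i^*$ the projections. Each $P_{\Sigma'}(R_i)$ is regarded as a language over $(A_{o,i}\cup\Sigma_i)\cap\Sigma'$, $L_C$ as a language over $\Sigma'$, and $R_i\parallel L_C$ as a language over $A_{o,i}\cup\Sigma_i\cup\Sigma'$. Languages $L_i$ are synchronously nonconflicting if $\overline{\parallel_i L_i}=\parallel_i\overline{L_i}$. $K\subseteq X^*$ is separable with respect to $(X_i)_i$ if $K=\parallel_i P_i(K)$. Let $N\subseteq X^*$ be prefix-closed with $X\subseteq A$, let $X_o\subseteq X$, $P_o\colon X^*\to X_o^*$ the projection, and $M\subseteq N$. - $M$ is controllable with respect to $N$ and $X_{uc}$ if $\overline{M}X_{uc}\cap N\subseteq\overline{M}$. - $M$ is normal with respect to $N$ and $X_o$ if $\overline{M}=P_o^{-1}P_o(\overline{M})\cap N$. - $M$ is observable with respect to $N$ and $X_o$ if for all $s\in\overline{M}$ and $a\in X\cap A_c$, $sa\notin\overline{M}$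 and $sa\in N$ imply $P_o^{-1}P_o(s)\{a\}\cap\overline{M}=\emptyset$. $P_{\Sigma'}$ is an $R_i$-observer if, with $P_{\Sigma'}$ restricted to words over $A_{o,i}\cup\Sigma_i$, for all $s\in\overline{R_i}$ and all $t$ with $P_{\Sigma'}(s)t\in P_{\Sigma'}(R_i)$ there exists $u\in(A_{o,i}\cup\Sigma_i)^*$ such that $su\in R_i$ and $P_{\Sigma'}(u)=t$. Given local observable alphabets $O_i\subseteq A$ and local controllable alphabets $C_i\subseteq A$ with $\bigcup_i C_i=A_c$, a language $M\subseteq L$ is coobservable with respect to $L$ and $(O_i)_{i=1}^n$ if for all $s\in\overline{M}$ and $a\in A_c$ with $sa\in L\setminus\overline{M}$ there is $i$ such that $a\in C_i$ and $Q_i^{-1}(Q_i(s))\{a\}\cap\overline{M}=\emptyset$, where $Q_i\colon A^*\to O_i^*$ is the projection. Here $O_i=A_{o,i}\cup\Sigma_{o,i}\cup\Sigma'_o$ and the (extended) local controllable alphabets are $C_i=A_{c,i}\cup\Sigma_{c,i}\cup\Sigma'_c$. *)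

(* Defs.v *)
From HB Require Import structures.
From mathcomp Require Import all_boot.
From mathcomp Require Import boolp classical_sets.

Set Implicit Arguments.
Unset Strict Implicit.
Unset Printing Implicit Defensive.

Local Open Scope classical_set_scope.

(* The global alphabet is a [finType] [A], its sub-alphabets are finite sets
   [X : {set A}], and a language over [X] is a [M : set (seq A)] included in
   [words X].  Since a language does not carry its alphabet, operations that
   depend on the alphabet take it as an argument. *)

Section Languages.
Variable A : finType.
Implicit Types (X Y : {set A}) (M N : set (seq A)).

Definition words X : set (seq A) := [set w | all (mem X) w].

Definition proj Y (w : seq A) : seq A := [seq a <- w | a \in Y].

(* Inverse image under [proj Y] seen as a morphism from [X]^* to [Y]^*. *)
Definition proj_inv X Y M : set (seq A) := words X `&` proj Y @^-1` M.

Definition prefix_closure M : set (seq A) := [set s | exists t, M (s ++ t)].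

Definition append M X : set (seq A) := [set rcons s a | s in M & a in [set` X]].

(* [M i] is a language over [X i]; the result is a language over the union of
   the [X i]. *)
Definition sync (n : nat) (X : 'I_n -> {set A}) (M : 'I_n -> set (seq A)) :
    set (seq A) :=
  [set w | words (\bigcup_(i < n) X i)%SET w /\ forall i, M i (proj (X i) w)].

Definition sync2 X M Y N : set (seq A) :=
  proj_inv (X :|: Y) X M `&` proj_inv (X :|: Y) Y N.

Definition nonconflicting (n : nat) (X : 'I_n -> {set A})
    (M : 'I_n -> set (seq A)) : Prop :=
  prefix_closure (sync X M) = sync X (fun i => prefix_closure (M i)).

Definition separable (n : nat) (X : 'I_n -> {set A}) (K : set (seq A)) : Prop :=
  K = sync X (fun i => proj (X i) @` K).

(* Controllability, normality, observability and coobservability are notions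
   for sublanguages [M] of [N]; the inclusion is part of the definitions. *)

Definition controllable N (Xuc : {set A}) M : Prop :=
  M `<=` N /\ append (prefix_closure M) Xuc `&` N `<=` prefix_closure M.

Definition normal X N (Xo : {set A}) M : Prop :=
  M `<=` N /\
  prefix_closure M = proj_inv X Xo (proj Xo @` prefix_closure M) `&` N.

Definition observable (Ac : {set A}) X N (Xo : {set A}) M : Prop :=
  M `<=` N /\
  forall s a, prefix_closure M s -> a \in X :&: Ac ->
    ~ prefix_closure M (rcons s a) -> N (rcons s a) ->
    append (proj_inv X Xo [set proj Xo s]) [set a]%SET `&` prefix_closure M
    = set0.

Definition coobservable (Ac : {set A}) (n : nat) (C : 'I_n -> {set A})
    N (O : 'I_n -> {set A}) M : Prop :=
  M `<=` N /\
  forall s a, prefix_closure M s -> a \in Ac ->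
    (N `\` prefix_closure M) (rcons s a) ->
    exists i, a \in C i /\
      append (proj_inv [set: A]%SET (O i) [set proj (O i) s]) [set a]%SET
        `&` prefix_closure M
      = set0.

(* [proj Y], as a morphism on [X]^*, is an [M]-observer. *)
Definition observer X Y M : Prop :=
  forall s t, prefix_closure M s -> (proj Y @` M) (proj Y s ++ t) ->
    exists u, [/\ words X u, M (s ++ u) & proj Y u = t].

Record generator := Generator {
  state : finType;
  trans : state -> A -> option state;
  initial : state;
  marked : {set state} }.

Fixpoint run (G : generator) (q : state G) (w : seq A) : option (state G) :=
  if w is a :: w' then obind (fun q' => run q' w') (trans q a) else Some q.

Definition generated (G : generator) : set (seq A) :=
  [set w | run (initial G) w <> None].

Definition marked_language (G : generator) : set (seq A) :=
  [set w | exists2 q, run (initial G) w = Some q & q \in marked G].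

Definition regular M : Prop := exists G : generator, marked_language G = M.

End Languages.

(* Selects normality or observability uniformly for all languages involved. *)
Variant obs_case := NormalCase | ObservableCase.

Definition normal_or_observable (c : obs_case) (A : finType) (Ac X : {set A})
    (N : set (seq A)) (Xo : {set A}) (M : set (seq A)) : Prop :=
  match c with
  | NormalCase => normal X N Xo M
  | ObservableCase => observable Ac X N Xo M
  end.

(* Main.v *)
Require Import Defs.
From HB Require Import structures.
From mathcomp Require Import all_boot.
From mathcomp Require Import boolp classical_sets.

(** Everything rests on describing the prefix closure of the supervised language
    [M] componentwise: a word [s] is a prefix of a word of [M] if and only if its
    projection to each [X_ i] is in the closure of [R i] and its projection to
    [Sigma'] is in the closure of [L_C].

    Only the converse direction has content ([glued_extension]).  The
    coordinator extends the projection of [s] to some word of [L_C], by a suffix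
    [t].  By the observer property, each component can follow [t] with a suffix
    [u i] of its own such that [u i] and [t] agree on the events that they share.
    Since distinct components share only events of [Sigma'], these local
    suffixes can be interleaved into one word ([glue]): between two consecutive
    events of [t] the components perform private events only, in any order.
    Nonconflictingness is a direct reading of this description.

    Controllability, normality and observability speak of prefix closures only,
    so once the closure of [M] is the intersection of the inverse images of the
    closures of its components, each of them passes from the components to [M].
    The coordinator is treated as one more component; the family is indexed by
    [option 'I_n].  For coobservability, an event that [M] disables is disabled
    by some component, say over [Z].  Since normality implies observability, that
    component can take the decision from its own observations.  It remains to
    name a supervisor that controls the event and sees at least as much: the
    supervisor [i] for the component [R i], and any supervisor for the
    coordinator, because every extended local alphabet contains the coordinator
    events. *)

Set Implicit Arguments.
Unset Strict Implicit.
Unset Printing Implicit Defensive.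

Local Open Scope classical_set_scope.

(** * Projections and prefix closures *)

Section Projections.
Variable A : finType.
Implicit Types (X Y Z : {set A}) (M N L : set (seq A)) (s t w : seq A).

Lemma proj_cat Y s t : proj Y (s ++ t) = proj Y s ++ proj Y t.
Proof. exact: filter_cat. Qed.

Lemma proj_rcons Y s a :
  proj Y (rcons s a) = if a \in Y then rcons (proj Y s) a else proj Y s.
Proof. exact: filter_rcons. Qed.

Lemma proj_proj X Y w : proj X (proj Y w) = proj (X :&: Y) w.
Proof. by rewrite /proj -filter_predI; apply: eq_filter => a; rewrite !inE. Qed.

Lemma proj_sub X Y w : X \subset Y -> proj X (proj Y w) = proj X w.
Proof. by move=> /finset.setIidPl XY; rewrite proj_proj XY. Qed.

Lemma eq_proj_sub X Y s t :
  X \subset Y -> proj Y s = proj Y t -> proj X s = proj X t.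
Proof. by move=> XY st; rewrite -(proj_sub s XY) st proj_sub. Qed.

Lemma words_proj Y w : words Y (proj Y w).
Proof. exact: filter_all. Qed.

Lemma wordsT w : words [set: A]%SET w.
Proof. by apply/allP => a _; rewrite !inE. Qed.

Lemma proj_words Y w : words Y w -> proj Y w = w.
Proof. by move/all_filterP. Qed.

Lemma prefix_closure_proj Y M (N : set (seq A)) :
  (forall w, M w -> N (proj Y w)) ->
  forall s, prefix_closure M s -> prefix_closure N (proj Y s).
Proof. by move=> MN s [t /MN st]; exists (proj Y t); rewrite -proj_cat. Qed.

Lemma generated_prefix (G : generator A) s t :
  generated G (s ++ t) -> generated G s.
Proof.
rewrite /generated /=; elim: s (initial G) => [//|a s IHs] q /=.
by case: (trans q a) => //= q'; exact: IHs.
Qed.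

End Projections.

(** * Gluing words that agree on the shared events *)

Section Gluing.
Variables (A : finType) (I : finType) (X : I -> {set A}) (S : {set A}).
Hypothesis shared : forall i j, i != j -> X i :&: X j \subset S.

Lemma proj_private i j w :
  i != j -> words (X j) w -> proj S w = [::] -> proj (X i) w = [::].
Proof.
move=> ij /allP Xw Sw; apply/eqP; rewrite -[_ == _]negbK -has_filter.
apply/hasPn => a aw; apply/negP => aXi.
have: a \in proj S w.
  rewrite mem_filter aw andbT; apply: (fintype.subsetP (shared ij)).
  by rewrite inE aXi; exact: Xw.
by rewrite Sw.
Qed.

(** Concatenation in any order works: a private word of one component is erased
    by the projections to all the others. *)
Lemma glue_private (p : I -> seq A) :
  (forall i, words (X i) (p i)) -> (forall i, proj S (p i) = [::]) ->
  exists v, (forall i, proj (X i) v = p i) /\ proj S v = [::].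
Proof.
move=> Xp Sp.
suff H (r : seq I) : uniq r -> exists v,
    (forall i, proj (X i) v = if i \in r then p i else [::]) /\ proj S v = [::].
  have [v [Xv Sv]] := H (enum I) (enum_uniq I).
  by exists v; split=> // i; rewrite Xv mem_enum.
elim: r => [_|i r IHr /= /andP[ir /IHr[v [Xv Sv]]]]; first by exists [::].
exists (p i ++ v); split=> [j|]; last by rewrite proj_cat Sp Sv.
rewrite proj_cat Xv inE; case: eqVneq => [->|ji] /=.
  by rewrite (negPf ir) cats0 proj_words.
by rewrite (proj_private ji).
Qed.

(** The first event of a projection splits the word at its first occurrence;
    a component that does not know the event has nothing to do before it. *)
Lemma split_shared Z u a t :
  words Z u -> proj S u = proj Z (a :: t) -> a \in S ->
  exists p u', [/\ u = p ++ proj Z [:: a] ++ u', words Z p, words Z u',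
                   proj S p = [::] & proj S u' = proj Z t].
Proof.
move=> Zu Su aS; move: Su => /=; case: ifP => aZ; last first.
  by move=> Su; exists [::], u.
elim: u Zu => [//|b u IHu] /= /andP[bZ Zu]; case: ifP => bS.
  by move=> [-> Su]; exists [::], u.
move=> /(IHu Zu)[p [u' [-> Zp Zu' Sp Su']]].
by exists (b :: p), u'; split => //=; rewrite ?bS //; apply/andP.
Qed.

(** Words over the [X i] that agree with a common word [t] on the shared events
    are the projections of one word: before each event of [t], each component
    performs its pending private events. *)
Lemma glue (t : seq A) (u : I -> seq A) :
  words S t -> (forall i, words (X i) (u i)) ->
  (forall i, proj S (u i) = proj (X i) t) ->
  exists v, (forall i, proj (X i) v = u i) /\ proj S v = t.
Proof.
elim: t u => [|a t IHt] u /=; first by move=> _; exact: glue_private.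
move=> /andP[aS0 St] Xu Su; have aS : a \in S := aS0.
have /choice[p /choice[u' Hpu]] i := split_shared (Xu i) (Su i) aS.
have [v1 [Xv1 Sv1]]: exists v, (forall i, proj (X i) v = p i) /\ proj S v = [::].
  by apply: glue_private => i; case: (Hpu i).
have [v2 [Xv2 Sv2]]: exists v, (forall i, proj (X i) v = u' i) /\ proj S v = t.
  by apply: IHt => // i; case: (Hpu i).
exists (v1 ++ [:: a] ++ v2); split=> [i|].
  by rewrite !proj_cat Xv1 Xv2; case: (Hpu i).
by rewrite !proj_cat Sv1 Sv2 /= aS.
Qed.

(** The coordinator [C] chooses the continuation on [S], the observer property
    lets each component follow it, and gluing makes the choices compatible. *)
Lemma glued_extension (R : I -> set (seq A)) (C : set (seq A)) s :
  (forall i, observer (X i) S (R i)) -> C `<=` words S ->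
  (forall w, C w -> forall i, (proj S @` R i) (proj (X i) w)) ->
  (forall i, prefix_closure (R i) (proj (X i) s)) ->
  prefix_closure C (proj S s) ->
  exists v, (forall i, R i (proj (X i) (s ++ v))) /\ C (proj S (s ++ v)).
Proof.
move=> obsR CS CR Rs [t Ct].
have St: words S t by move: (CS _ Ct); rewrite /words /= all_cat => /andP[].
have /choice[u Hu] i: exists u,
    [/\ words (X i) u, R i (proj (X i) s ++ u) & proj S u = proj (X i) t].
  apply: obsR (Rs i) _; move: (CR _ Ct i).
  by rewrite proj_cat !proj_proj finset.setIC.
have [v [Xv Sv]]: exists v, (forall i, proj (X i) v = u i) /\ proj S v = t.
  by apply: glue => // i; case: (Hu i).
exists v; rewrite proj_cat Sv; split=> // i.
by rewrite proj_cat Xv; case: (Hu i).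
Qed.

End Gluing.

(** * Observability as inference between indistinguishable words *)

Section Observability.
Variable A : finType.
Implicit Types (X : {set A}) (M N L : set (seq A)) (s t w : seq A).

Lemma append_proj_invP X Xo M s a :
  append (proj_inv X Xo [set proj Xo s]) [set a]%SET `&` prefix_closure M = set0
  <-> forall s', words X s' -> proj Xo s' = proj Xo s ->
        ~ prefix_closure M (rcons s' a).
Proof.
split=> [E s' Xs' ss' Ms'|H].
  have : set0 (rcons s' a); last by [].
  rewrite -E; split=> //; exists s' => //; exists a => //=.
  by rewrite inE.
rewrite -subset0 => w [[s' [Xs' ss'] [b /=]]].
by rewrite inE => /eqP-> <-; exact: H.
Qed.

(** The contrapositive form: what a word does after an event carries over to all
    words that look the same. *)
Lemma observable_transfer Ac X N Xo M :
  observable Ac X N Xo M ->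
  forall s s' a, prefix_closure M s -> a \in X :&: Ac -> N (rcons s a) ->
    words X s' -> proj Xo s' = proj Xo s -> prefix_closure M (rcons s' a) ->
    prefix_closure M (rcons s a).
Proof.
move=> [_ obs] s s' a Ms aX Nsa Xs' ss' Ms'a; apply: contrapT => Msa.
by have /append_proj_invP/(_ _ Xs' ss') := obs s a Ms aX Msa Nsa.
Qed.

Lemma normal_observable Ac X N Xo M :
  normal X N Xo M -> observable Ac X N Xo M.
Proof.
move=> [MN norm]; split=> // s a Ms aXc Msa Nsa.
apply/append_proj_invP => s' _ ss' Ms'a; apply: Msa.
rewrite norm; split=> //; split; last first.
  by exists (rcons s' a) => //; rewrite !proj_rcons ss'.
have [[Xs _] _] : (proj_inv X Xo (proj Xo @` prefix_closure M) `&` N) s.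
  by rewrite -norm.
rewrite /words /= all_rcons; apply/andP; split=> //.
by move: aXc; rewrite inE => /andP[].
Qed.

Lemma normal_or_observableW c Ac X N Xo M :
  normal_or_observable c Ac X N Xo M -> observable Ac X N Xo M.
Proof. by case: c => //; exact: normal_observable. Qed.

End Observability.

(** * Properties inherited from the components of a closure *)

Section Components.
Variables (A : finType) (I : Type) (Z : I -> {set A}) (B : I -> set (seq A)).
Variables (L M : set (seq A)).
Hypothesis ML : M `<=` L.
Hypothesis closure_M : forall s,
  prefix_closure M s <-> forall k, prefix_closure (B k) (proj (Z k) s).

Lemma controllable_components (U : {set A}) :
  (forall k, controllable (proj (Z k) @` L) (Z k :&: U) (B k)) ->
  controllable L U M.
Proof.
move=> ctrl; split=> // _ [[s /closure_M Ms [a aU <-]] Lsa].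
apply/closure_M => k; rewrite proj_rcons; case: ifP => // aZ.
apply: (ctrl k).2; split.
  by exists (proj (Z k) s) => //; exists a => //=; rewrite inE aZ.
by exists (rcons s a); rewrite ?proj_rcons ?aZ.
Qed.

Variable Zo : I -> {set A}.
Hypothesis Zo_sub : forall k, Zo k \subset Z k.

Lemma normal_components (Ao : {set A}) :
  (forall s t, L (s ++ t) -> L s) ->
  (forall k, Zo k \subset Ao) ->
  (forall k, normal (Z k) (proj (Z k) @` L) (Zo k) (B k)) ->
  normal [set: A]%SET L Ao M.
Proof.
move=> Lpre ZoA norm; split=> //; apply/seteqP; split=> s.
  move=> Ms; split; last by case: Ms => t /ML/Lpre.
  by split; [exact: wordsT | exists s].
move=> [[_ [s' /closure_M Ms' ss']] Ls]; apply/closure_M => k.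
rewrite (norm k).2; split; last by exists s.
split; first exact: words_proj.
exists (proj (Z k) s') => //; rewrite !proj_sub //.
exact: eq_proj_sub (ZoA k) ss'.
Qed.

Variable Ac : {set A}.
Hypothesis obs : forall k,
  observable Ac (Z k) (proj (Z k) @` L) (Zo k) (B k).

Lemma component_transfer k s s' a :
  a \in Ac -> L (rcons s a) -> proj (Zo k) s' = proj (Zo k) s ->
  prefix_closure M s -> prefix_closure M (rcons s' a) ->
  prefix_closure (B k) (proj (Z k) (rcons s a)).
Proof.
move=> aAc Lsa ss' /closure_M/(_ k) Ms /closure_M/(_ k).
have Lk : (proj (Z k) @` L) (proj (Z k) (rcons s a)) by exists (rcons s a).
move: Lk; rewrite !proj_rcons; case: ifP => // aZ Lk.
apply: (observable_transfer (obs k)) => //; first by rewrite inE aZ.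
  exact: words_proj.
by rewrite !proj_sub.
Qed.

Lemma observable_components (Ao : {set A}) :
  (forall k, Zo k \subset Ao) -> observable Ac [set: A]%SET L Ao M.
Proof.
move=> ZoA; split=> // s a Ms; rewrite inE => /andP[_ aAc] Msa Lsa.
apply/append_proj_invP => s' _ ss' Ms'a; apply/Msa/closure_M => k.
by apply: (component_transfer (s' := s')) => //; exact: eq_proj_sub (ZoA k) ss'.
Qed.

(** Disabling an event is the decision of one component, so it suffices that
    some supervisor controls the event and observes what that component does. *)
Lemma coobservable_components n (C O : 'I_n -> {set A}) :
  (forall k a, a \in Z k -> a \in Ac ->
     exists2 i, a \in C i & Zo k \subset O i) ->
  coobservable Ac C L O M.
Proof.
move=> sup; split=> // s a Ms aAc [Lsa Msa].
have [k Bk] : exists k, ~ prefix_closure (B k) (proj (Z k) (rcons s a)).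
  by apply/existsNP => H; exact/Msa/closure_M.
have aZ : a \in Z k.
  apply/negPn/negP => /negPf aZ; apply: Bk; rewrite proj_rcons aZ.
  by move/closure_M: Ms.
have [i aC ZoO] := sup k a aZ aAc; exists i; split=> //.
apply/append_proj_invP => s' _ ss' Ms'a; apply: Bk.
by apply: (component_transfer (s' := s')) => //; exact: eq_proj_sub ZoO ss'.
Qed.

End Components.

(** * The coordinated system *)

Theorem theorem12
  (A : finType) (A_nonempty : 0 < #|A|)
  (G : generator A) (n : nat)
  (A_c_ A_o_ : 'I_n -> {set A})
  (A_c := (\bigcup_(i < n) A_c_ i)%SET)
  (A_o := (\bigcup_(i < n) A_o_ i)%SET)
  (A_uc := ~: A_c)
  (L := generated G)
  (K : set (seq A)) (K_regular : regular K) (K_sub : K `<=` L)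
  (Sigma_ : 'I_n -> {set A})
  (X_ := fun i => A_o_ i :|: Sigma_ i)
  (X_cover : (\bigcup_(i < n) X_ i)%SET = [set: A]%SET)
  (K_separable : separable X_ K)
  (Sigma_o_ := fun i => Sigma_ i :&: A_o)
  (Sigma_c_ := fun i => Sigma_ i :&: A_c)
  (local_oc : forall i,
     (A_o_ i :|: Sigma_o_ i) :&: A_c \subset A_c_ i :|: Sigma_c_ i)
  (R : 'I_n -> set (seq A))
  (R_regular : forall i, regular (R i))
  (R_over : forall i, R i `<=` words (X_ i))
  (R_controllable : forall i,
     controllable (proj (X_ i) @` L) (X_ i :&: A_uc) (R i))
  (R_sub : sync X_ R `<=` K)
  (c : obs_case)
  (R_obs : forall i,
     normal_or_observable c A_c (X_ i) (proj (X_ i) @` L)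
       (A_o_ i :|: Sigma_o_ i) (R i))
  (c_obs : c = ObservableCase -> A_c \subset A_o)
  (Sigma' : {set A})
  (Sigma'_shared : forall i j, i != j -> X_ i :&: X_ j \subset Sigma')
  (Sigma'_uc := Sigma' :&: A_uc) (Sigma'_c := Sigma' :&: A_c) (Sigma'_o := Sigma' :&: A_o)
  (R_observer : forall i, observer (X_ i) Sigma' (R i))
  (L_C : set (seq A)) (L_C_regular : regular L_C)
  (L_C_over : L_C `<=` words Sigma')
  (L_C_sub : L_C `<=` sync (fun i => X_ i :&: Sigma') (fun i => proj Sigma' @` R i))
  (L_C_controllable : controllable (proj Sigma' @` L) Sigma'_uc L_C)
  (L_C_obs : normal_or_observable c A_c Sigma' (proj Sigma' @` L) Sigma'_o L_C)
  (extended_oc : forall i,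
     (A_o_ i :|: Sigma_o_ i :|: Sigma'_o) :&: A_c
       \subset A_c_ i :|: Sigma_c_ i :|: Sigma'_c) :
  let Y_ := fun i => X_ i :|: Sigma' in
  let T := fun i => sync2 (X_ i) (R i) Sigma' L_C in
  let M := sync Y_ T in
  [/\ M `<=` K,
      controllable L A_uc M,
      normal_or_observable c A_c [set: A]%SET L A_o M,
      coobservable A_c (fun i => A_c_ i :|: Sigma_c_ i :|: Sigma'_c) L
        (fun i => A_o_ i :|: Sigma_o_ i :|: Sigma'_o) M
    & nonconflicting Y_ T].
Proof.
move=> Y T M.
(* A nonempty alphabet cannot be covered by no component; the index [i0] is
   what makes the coordinator take part in the product. *)
have [i0 _] : exists i0 : 'I_n, true.
  have [a _] := card_gt0P A_nonempty.
  have : a \in (\bigcup_(i < n) X_ i)%SET by rewrite X_cover inE.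
  by move=> /finset.bigcupP[i _ _]; exists i.
have wordsX w : words (\bigcup_(i < n) X_ i)%SET w by rewrite X_cover; exact: wordsT.
have wordsY w : words (\bigcup_(i < n) Y i)%SET w.
  apply: sub_all (wordsX w) => a /finset.bigcupP[i iT aX].
  by apply/finset.bigcupP; exists i => //; rewrite inE aX.
have TE i w : T i (proj (Y i) w) <-> R i (proj (X_ i) w) /\ L_C (proj Sigma' w).
  have [EX ES] : proj (X_ i) (proj (Y i) w) = proj (X_ i) w /\
                 proj Sigma' (proj (Y i) w) = proj Sigma' w.
    by rewrite !proj_sub ?finset.subsetUl ?finset.subsetUr.
  rewrite /T /sync2 /proj_inv /= EX ES.
  by split=> [[[]] ? ? []|[? ?]] //; do 2?split => //; exact: words_proj.
have ME w : M w <-> (forall i, R i (proj (X_ i) w)) /\ L_C (proj Sigma' w).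
  split=> [[_ Tw]|[Rw Cw]].
    by split=> [i|]; [case/TE: (Tw i) | case/TE: (Tw i0)].
  by split=> // i; apply/TE.
have extend s : (forall i, prefix_closure (R i) (proj (X_ i) s)) ->
    prefix_closure L_C (proj Sigma' s) -> prefix_closure M s.
  move=> Rs Cs.
  have LCR w : L_C w -> forall i, (proj Sigma' @` R i) (proj (X_ i) w).
    move=> Cw i; have [_ /(_ i)] := L_C_sub _ Cw.
    by rewrite -proj_proj (proj_words (L_C_over _ Cw)).
  have [v Mv] := glued_extension Sigma'_shared R_observer L_C_over LCR Rs Cs.
  by exists v; apply/ME.
pose Z k := if k is Some i then X_ i else Sigma'.
pose B k := if k is Some i then R i else L_C.
pose Zo k := if k is Some i then A_o_ i :|: Sigma_o_ i else Sigma'_o.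
have closure_M s : prefix_closure M s <->
    forall k : option 'I_n, prefix_closure (B k) (proj (Z k) s).
  split=> [Ms k|Bs]; last first.
    by apply: extend => [i|]; [exact: (Bs (Some i)) | exact: (Bs None)].
  by apply: prefix_closure_proj Ms => w /ME[Rw Cw]; case: k => [i|] /=.
have MK : M `<=` K by move=> w /ME[Rw _]; apply: R_sub; split.
have ML : M `<=` L by move=> w /MK/K_sub.
have Zo_sub k : Zo k \subset Z k.
  by case: k => [i|] /=; rewrite ?finset.subsetIl // finset.setUS // finset.subsetIl.
have ZoA k : Zo k \subset A_o.
  case: k => [i|] /=; last exact: finset.subsetIr.
  by rewrite finset.subUset finset.subsetIr andbT; exact: finset.bigcup_sup.
have obsB k : normal_or_observable c A_c (Z k) (proj (Z k) @` L) (Zo k) (B k).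
  by case: k.
have obsB' k := normal_or_observableW (obsB k).
split=> //.
- apply: (controllable_components (Z := Z) (B := B)) => //.
  by case.
- case: c obsB {R_obs L_C_obs c_obs} => obsB /=.
    apply: (normal_components ML closure_M Zo_sub _ ZoA obsB).
    exact: generated_prefix.
  exact: (observable_components ML closure_M Zo_sub obsB').
- apply: (coobservable_components ML closure_M Zo_sub obsB') => -[i|] a /= aZ aAc.
    exists i; last exact: finset.subsetUl.
    rewrite inE; apply/orP; left.
    move: aZ; rewrite inE => /orP[aA|aS]; last by rewrite !inE aS aAc orbT.
    by apply: (fintype.subsetP (local_oc i)); rewrite !inE aA aAc.
  by exists i0; [rewrite !inE aZ aAc !orbT | exact: finset.subsetUr].
- apply/seteqP; split=> s.
    move=> Ms; split=> // i; apply: prefix_closure_proj Ms => w /ME[Rw Cw].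
    exact/TE.
  move=> [_ Ts].
  have TX i : forall w, T i w -> R i (proj (X_ i) w) by move=> w [[]].
  have TS i : forall w, T i w -> L_C (proj Sigma' w) by move=> w [_ []].
  apply: extend => [i|].
    have := prefix_closure_proj (TX i) (Ts i).
    by rewrite proj_sub ?finset.subsetUl.
  have := prefix_closure_proj (TS i0) (Ts i0).
  by rewrite proj_sub ?finset.subsetUr.
Qed.
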